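(* For any $(x,y)\in P\cap\mathbb{R}^{m+s}_{++}$, $G^w(x,y)=G(x,y)$. Moreover, the efficiency measure $G$ is strongly monotonic on $P\cap\mathbb{R}^{m+s}_{++}$, i.e., for all $(x,y),(\bar x,\bar y)\in P\cap\mathbb{R}^{m+s}_{++}$ with $(x,-y)\le(\bar x,-\bar y)$ and $(x,-y)\neq(\bar x,-\bar y)$, one has $G(x,y)>G(\bar x,\bar y)$.
   Context: Notation: vector inequalities are componentwise ($a\le b$ means $a_i\le b_i$ for all $i$; $a<b$ means $a_i<b_i$ for all $i$). $\mathbb{R}_+$ denotes the nonnegative reals and $\mathbb{R}_{++}$ the positive reals. $e_l$ is the $l$-th unit vector of the space of appropriate dimension. Let $m,s,n\ge 1$ be integers. Data: observed input-output vectors $(x_j,y_j)\in\mathbb{R}^{m+s}_{++}$, $j=1,\dots,n$ (with $x_j\in\mathbb{R}^m$, $y_j\in\mathbb{R}^s$). The production possibility set (variable returns to scale) is $$P=\Big\{(x,y)\in\mathbb{R}^{m+s}_+ : \exists \lambda\ge 0,\ \sum_{j=1}^n\lambda_jx_j\le x,\ \sum_{j=1}^n\lambda_jy_j\ge y,\ \sum_{j=1}^n\lambda_j=1\Big\}.$$ For a set $\mathcal{P}\subseteq\mathbb{R}^{m+s}_+$, the weakly efficient frontier $\partial^w(\mathcal{P})$ is the set of $(x,y)\in\mathcal{P}$ such that $(x',-y')<(x,-y)$ implies $(x',y')\notin\mathcal{P}$; the strongly efficient frontier $\partial^s(\mathcal{P})$ is the set of $(x,y)\in\mathcal{P}$ such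 that $(x',y')\ne(x,y)$ and $(x',-y')\le(x,-y)$ imply $(x',y')\notin\mathcal{P}$. A face of $P$ is a set $\mathcal{F}=P\cap\{(x,y): -v^\top x+u^\top y-\psi=0\}$ with $(v,u,\psi)\in\mathbb{R}^{m+s}_+\times\mathbb{R}$ such that $-v^\top x+u^\top y-\psi\le 0$ for all $(x,y)\in P$. A full-dimensional efficient facet (FDEF) of $P$ is a face $\mathcal{F}\subseteq\partial^s(P)$ with $\dim\mathcal{F}=m+s-1$. Assume $P$ has at least one FDEF, and let $\mathcal{F}_1,\dots,\mathcal{F}_K$ be all the FDEFs of $P$. For each $k$ there are $(v^k,u^k)\in\mathbb{R}^{m+s}_{++}$ and $\psi^k\in\mathbb{R}$ with $\mathcal{F}_k=P\cap\{(x,y): -v^{k\top}x+u^{k\top}y-\psi^k=0\}$ and $-v^{k\top}x+u^{k\top}y-\psi^k\le0$ on $P$. The extended facet production possibility set is $$P_{EXFA}=\Big\{(x,y)\in\mathbb{R}^{m+s}_+ : -\sum_{i=1}^m v^k_ix_i+\sum_{r=1}^s u^k_ry_r\le\psi^k,\ k=1,\dots,K\Big\}.$$ For $\theta\in\mathbb{R}^m$ and $\phi\in\mathbb{R}^s_{++}$ let $g(\theta,\phi)=\frac{1}{m+s}\big(\sum_{i=1}^m\theta_i+\sum_{r=1}^s\frac{1}{\phi_r}\big)$. For $(x,y)\in P\cap\mathbb{R}^{m+s}_{++}$, the maximum Russell graph measure $G(x,y)$ is the maximum of $g(\theta,\phi)$ over all $(\theta,\phi)$ with $0\le\theta_i\le1$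 ($i=1,\dots,m$), $1\le\phi_r$ ($r=1,\dots,s$) and $\big(\sum_{i=1}^m\theta_ix_ie_i,\sum_{r=1}^s\phi_ry_re_r\big)\in\partial^s(P_{EXFA})$. $G^w(x,y)$ is defined in the same way with $\partial^s(P_{EXFA})$ replaced by $\partial^w(P_{EXFA})$. *)

(* Defs.v *)
From mathcomp Require Import all_boot all_order all_algebra.
From mathcomp Require Import boolp classical_sets reals.

Set Implicit Arguments.
Unset Strict Implicit.
Unset Printing Implicit Defensive.
Import Order.TTheory GRing.Theory Num.Theory.
Local Open Scope classical_set_scope.
Local Open Scope ring_scope.

Definition lev (R : realType) (n : nat) (a b : 'rV[R]_n) : Prop :=
  forall i, a 0 i <= b 0 i.

Definition ltv (R : realType) (n : nat) (a b : 'rV[R]_n) : Prop :=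
  forall i, a 0 i < b 0 i.

Definition dotv (R : realType) (n : nat) (a b : 'rV[R]_n) : R :=
  \sum_(i < n) a 0 i * b 0 i.

(* An input-output vector (x, y) of R^(m+s), kept as a pair; the product
   carries the library's vector-space structure of dimension m + s. *)
Notation io_vec R m s := ('rV[R]_m * 'rV[R]_s)%type.

Definition nonneg_point (R : realType) (m s : nat) : set (io_vec R m s) :=
  [set z | lev 0 z.1 /\ lev 0 z.2].

Definition pos_point (R : realType) (m s : nat) : set (io_vec R m s) :=
  [set z | ltv 0 z.1 /\ ltv 0 z.2].

(* (x', -y') <= (x, -y) *)
Definition le_io (R : realType) (m s : nat) (z' z : io_vec R m s) : Prop :=
  lev z'.1 z.1 /\ lev (- z'.2) (- z.2).

(* (x', -y') < (x, -y), strictly in every component *)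
Definition lt_io (R : realType) (m s : nat) (z' z : io_vec R m s) : Prop :=
  ltv z'.1 z.1 /\ ltv (- z'.2) (- z.2).

Definition production_set (R : realType) (m s n : nat)
    (D : 'I_n -> io_vec R m s) : set (io_vec R m s) :=
  [set z | nonneg_point z /\
    exists lam : 'I_n -> R,
      [/\ forall j, 0 <= lam j,
          lev (\sum_(j < n) lam j *: (D j).1) z.1,
          lev z.2 (\sum_(j < n) lam j *: (D j).2) &
          \sum_(j < n) lam j = 1]].

Definition weak_frontier (R : realType) (m s : nat)
    (A : set (io_vec R m s)) : set (io_vec R m s) :=
  [set z | A z /\ forall z', lt_io z' z -> ~ A z'].

Definition strong_frontier (R : realType) (m s : nat)
    (A : set (io_vec R m s)) : set (io_vec R m s) :=
  [set z | A z /\ forall z', z' <> z -> le_io z' z -> ~ A z'].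

(* The affine functional -v^T x + u^T y - psi, with w = (v, u). *)
Definition aff_form (R : realType) (m s : nat) (w : io_vec R m s) (psi : R)
    (z : io_vec R m s) : R :=
  - dotv w.1 z.1 + dotv w.2 z.2 - psi.

Definition valid_on (R : realType) (m s : nat) (A : set (io_vec R m s))
    (w : io_vec R m s) (psi : R) : Prop :=
  forall z, A z -> aff_form w psi z <= 0.

Definition face_of (R : realType) (m s : nat) (A : set (io_vec R m s))
    (w : io_vec R m s) (psi : R) : set (io_vec R m s) :=
  A `&` [set z | aff_form w psi z = 0].

Definition is_face (R : realType) (m s : nat)
    (A F : set (io_vec R m s)) : Prop :=
  exists (w : io_vec R m s) (psi : R),
    [/\ nonneg_point w, valid_on A w psi & F = face_of A w psi].

Definition aff_free (R : realType) (V : vectType R) (l : seq V) : bool :=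
  if l is p0 :: l' then free [seq p - p0 | p <- l'] else true.

(* dim A = d, for the affine dimension: the largest number of affinely
   independent points of A is d + 1. *)
Definition has_dim (R : realType) (V : vectType R) (A : set V) (d : nat) :
    Prop :=
  (exists l : seq V,
     [/\ aff_free l, forall p, p \in l -> A p & size l = d.+1]) /\
  (forall l : seq V,
     aff_free l -> (forall p, p \in l -> A p) -> (size l <= d.+1)%N).

(* Full-dimensional efficient facet. *)
Definition FDEF (R : realType) (m s : nat) (A F : set (io_vec R m s)) : Prop :=
  [/\ is_face A F, F `<=` strong_frontier A & has_dim F (m + s - 1)%N].

Definition P_EXFA (R : realType) (m s K : nat) (w : 'I_K -> io_vec R m s)
    (psi : 'I_K -> R) : set (io_vec R m s) :=
  [set z | nonneg_point z /\
    forall k, - dotv (w k).1 z.1 + dotv (w k).2 z.2 <= psi k].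

Definition g (R : realType) (m s : nat) (t : io_vec R m s) : R :=
  (m + s)%N%:R^-1 *
  (\sum_(i < m) t.1 0 i + \sum_(r < s) (t.2 0 r)^-1).

(* The point (sum_i theta_i x_i e_i, sum_r phi_r y_r e_r), for
   t = (theta, phi) and z = (x, y). *)
Definition rescale (R : realType) (m s : nat) (t z : io_vec R m s) :
    io_vec R m s :=
  (\row_i (t.1 0 i * z.1 0 i), \row_r (t.2 0 r * z.2 0 r)).

(* The values of g at the pairs (theta, phi) admissible for z when the
   projection must lie in the frontier B. *)
Definition russell_values (R : realType) (m s : nat) (B : set (io_vec R m s))
    (z : io_vec R m s) : set R :=
  [set g t | t in [set t : io_vec R m s |
    [/\ forall i, 0 <= t.1 0 i <= 1,
        forall r, 1 <= t.2 0 r &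
        B (rescale t z)]]].

Definition is_maximum (R : realType) (A : set R) (c : R) : Prop :=
  A c /\ ubound A c.

(* The maximum of A, with the junk value 0 when A has none. *)
Definition maximum (R : realType) (A : set R) : R :=
  xget 0 [set c | is_maximum A c].

Definition russell_strong (R : realType) (m s : nat) (E : set (io_vec R m s))
    (z : io_vec R m s) : R :=
  maximum (russell_values (strong_frontier E) z).

Definition russell_weak (R : realType) (m s : nat) (E : set (io_vec R m s))
    (z : io_vec R m s) : R :=
  maximum (russell_values (weak_frontier E) z).

(* Main.v *)
Require Import Defs.
From mathcomp Require Import all_boot all_order all_algebra.
From mathcomp Require Import boolp classical_sets reals.
From mathcomp Require Import cardinality topology normedtype derive.
From mathcomp Require Import ring lra.

(** Facet normals are positive, so a point of the extended facet set is strongly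
    efficient exactly when it lies on one of the facet hyperplanes
    ([tight_strong], [strong_tight]), and the weak frontier adds only points
    with a zero input ([weak_tight_or_zero]).  A point [z] of the production set
    satisfies all the facet inequalities, so the measure may be studied for any
    positive point of the extended set.

    Everything rests on one improvement argument ([infeasible_improve]).  If
    factors [t] rescale [z] to a point outside the set, then on the segment from
    the factors (1, ..., 1), which give [z] itself, to [t] the first facet
    hyperplane met yields a strongly efficient point, and its factors have a
    value of [g] strictly larger than that of [t].

    It follows that a factor theta_i = 0 is never optimal
    ([zero_input_improve]): replace it by 1 and one output factor by a huge
    number.  The sum defining [g] gains 1 and loses less than 1, and the new
    point is infeasible, hence improvable.  So the weak frontier brings no larger
    value than the strong one.  The maxima exist since the factors that
    lead to the strong frontier form a compact set ([strong_maximum_exists]).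

    For strict monotonicity, use the optimal factors of the dominated point at
    the dominating one.  As those factors are all positive, the rescaled point
    moves strictly beyond a facet hyperplane; it is infeasible, and the
    improvement argument gives a strictly larger value
    ([strong_maximum_lt]). *)

Set Implicit Arguments.
Unset Strict Implicit.
Unset Printing Implicit Defensive.
Import Order.TTheory GRing.Theory Num.Theory.
Local Open Scope classical_set_scope.
Local Open Scope ring_scope.

Import numFieldNormedType.Exports.

(** * Finite systems of affine inequalities in one variable *)

Lemma exists_small_step (R : realType) (I : finType) (b c : I -> R) :
  (forall i, 0 < c i) ->
  exists2 eps, 0 < eps & forall i, eps * b i <= c i.
Proof.
move=> c0; pose f i := c i / (`|b i| + 1).
have f0 i : 0 < f i by rewrite divr_gt0// ltr_wpDl.
exists (\big[Order.min/1]_i f i); first by apply: lt_bigmin.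
move=> i; have : \big[Order.min/1]_i f i <= f i by exact: bigmin_le_cond.
set e := \big[Order.min/1]_i f i => ef.
have e0 : 0 < e by apply: lt_bigmin.
have b1 : 0 < `|b i| + 1 by rewrite ltr_wpDl.
rewrite ler_pdivlMr// in ef.
apply: le_trans ef; rewrite ler_pM2l//.
by have := ler_norm (b i); lra.
Qed.

(** The first parameter at which one of the increasing constraints becomes an
    equality: the smallest of the ratios [c i / b i]. *)
Lemma exists_first_crossing (R : realType) (I : finType) (b c : I -> R) i0 :
  (forall i, 0 <= c i) -> c i0 < b i0 ->
  exists tau, [/\ 0 <= tau, tau < 1, forall i, tau * b i <= c i &
                  exists i, tau * b i = c i].
Proof.
move=> c0 cb; have b0 : 0 < b i0 by exact: le_lt_trans cb.
case: (@arg_minP _ _ _ i0 (fun i => 0 < b i) (fun i => c i / b i) b0).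
move=> i bi imin; exists (c i / b i); split.
- by rewrite divr_ge0// ltW.
- by apply: le_lt_trans (imin _ b0) _; rewrite ltr_pdivrMr// mul1r.
- move=> j; have [bj|bj] := ltP 0 (b j).
    by have := imin _ bj; rewrite [_ <= c j / b j]ler_pdivlMr.
  apply: le_trans (c0 j); apply: mulr_ge0_le0 => //.
  by rewrite divr_ge0// ltW.
- by exists i; rewrite divfK// gt_eqF.
Qed.

(** * The order on input-output vectors *)

Section order.
Variables (R : realType) (m s : nat).
Implicit Types (z t w d : io_vec R m s).

Lemma le_ioE z' z : le_io z' z ->
  (forall i, z'.1 0 i <= z.1 0 i) /\ (forall r, z.2 0 r <= z'.2 0 r).
Proof. by move=> [h1 h2]; split=> // r; have := h2 r; rewrite !mxE lerN2. Qed.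

Lemma le_ioI z' z : (forall i, z'.1 0 i <= z.1 0 i) ->
  (forall r, z.2 0 r <= z'.2 0 r) -> le_io z' z.
Proof. by move=> h1 h2; split=> // r; rewrite !mxE lerN2. Qed.

Lemma le_io_neq_coord z' z : le_io z' z -> z' <> z ->
  (exists i, z'.1 0 i < z.1 0 i) \/ (exists r, z.2 0 r < z'.2 0 r).
Proof.
move=> /le_ioE[h1 h2] zz; apply: contrapT => /not_orP[n1 n2]; apply: zz.
rewrite [LHS]surjective_pairing [RHS]surjective_pairing.
congr (_, _); apply/rowP => i; apply/eqP.
  by rewrite eq_le h1/= leNgt; apply/negP => h; apply: n1; exists i.
by rewrite eq_le h2 andbT leNgt; apply/negP => h; apply: n2; exists i.
Qed.

Lemma ltr_sum_ex (I : finType) (f h : I -> R) :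
  (forall i, f i <= h i) -> (exists i, f i < h i) ->
  \sum_i f i < \sum_i h i.
Proof.
move=> fh [i fhi]; rewrite (bigD1 i)//= [ltRHS](bigD1 i)//=.
by apply: ltr_leD => //; exact: ler_sum.
Qed.

Lemma ltr_sum2_ex (I J : finType) (f h : I -> R) (f' h' : J -> R) :
  (forall i, f i <= h i) -> (forall j, f' j <= h' j) ->
  (exists i, f i < h i) \/ (exists j, f' j < h' j) ->
  \sum_i f i + \sum_j f' j < \sum_i h i + \sum_j h' j.
Proof.
move=> fh fh' [] e; first by apply: ltr_leD; [exact: ltr_sum_ex|exact: ler_sum].
by apply: ler_ltD; [exact: ler_sum|exact: ltr_sum_ex].
Qed.

(** This strict monotonicity is what turns every point on a facet hyperplane
    into a strongly efficient one. *)
Lemma aff_form_lt w psi z' z : pos_point w -> le_io z' z -> z' <> z ->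
  aff_form w psi z < aff_form w psi z'.
Proof.
move=> [w1 w2] lezz nzz; rewrite /aff_form ltrD2r /dotv -!sumrN.
have [h1 h2] := le_ioE lezz.
have w1' i : 0 < w.1 0 i by have := w1 i; rewrite mxE.
have w2' i : 0 < w.2 0 i by have := w2 i; rewrite mxE.
apply: ltr_sum2_ex.
- by move=> i; rewrite lerN2 ler_pM2l.
- by move=> i; rewrite ler_pM2l.
- by case: (le_io_neq_coord lezz nzz) => -[i hi]; [left|right]; exists i;
    rewrite ?ltrN2 ltr_pM2l.
Qed.

Lemma g_lt t t' : (0 < m)%N -> ltv 0 t'.2 -> le_io t t' -> t <> t' ->
  g t < g t'.
Proof.
move=> m0 t0 lett ntt; rewrite /g ltr_pM2l; last first.
  by rewrite invr_gt0 ltr0n addn_gt0 m0.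
have [h1 h2] := le_ioE lett.
have t0' r : 0 < t'.2 0 r by have := t0 r; rewrite mxE.
have t0'' r : 0 < t.2 0 r by apply: lt_le_trans (h2 r).
apply: ltr_sum2_ex => [i|r|]; [exact: h1|by rewrite lef_pV2 ?posrE|].
case: (le_io_neq_coord lett ntt) => -[i hi]; [left|right]; exists i => //.
by rewrite ltf_pV2 ?posrE.
Qed.

Lemma aff_formD w psi z tau d :
  aff_form w psi (z + tau *: d) = aff_form w psi z + tau * aff_form w 0 d.
Proof.
rewrite /aff_form /dotv /= subr0.
have E k (a b c : 'rV[R]_k) : \sum_(i < k) a 0 i * (b + tau *: c) 0 i =
    \sum_(i < k) a 0 i * b 0 i + tau * \sum_(i < k) a 0 i * c 0 i.
  rewrite mulr_sumr -big_split; apply: eq_bigr => i _ /=; rewrite !mxE; ring.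
rewrite !E; ring.
Qed.

Lemma aff_formB w psi z' z :
  aff_form w 0 (z' - z) = aff_form w psi z' - aff_form w psi z.
Proof.
have := aff_formD w psi z 1 (z' - z).
by rewrite scale1r subrKC mul1r => ->; rewrite addrAC subrr add0r.
Qed.

End order.

(** * Frontiers of the extended facet set *)

Section frontiers.
Variables (R : realType) (m s K : nat).
Variables (w : 'I_K -> io_vec R m s) (psi : 'I_K -> R).
Implicit Types (z t d : io_vec R m s).
Let E := P_EXFA w psi.
Let h k z := aff_form (w k) (psi k) z.

Lemma P_EXFAP z : E z <-> nonneg_point z /\ forall k, h k z <= 0.
Proof.
by split=> -[z0 hz]; split=> // k; have := hz k; rewrite /h /aff_form subr_le0.
Qed.

Hypothesis w_gt0 : forall k, pos_point (w k).

(** A dominating point has a strictly larger value of the tight functional, so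
    it violates that facet inequality. *)
Lemma tight_strong z k : E z -> h k z = 0 -> strong_frontier E z.
Proof.
move=> Ez hk; split=> // z' nz lez /P_EXFAP[_ /(_ k)].
have := aff_form_lt (psi k) (w_gt0 k) lez nz.
by rewrite -/(h k z) hk ltNge => /negP.
Qed.

(** Finitely many strict inequalities leave room for a common step; inputs that
    do not decrease along [d] are given the vacuous bound [0 <= 1]. *)
Lemma slack_move z d : E z -> (forall k, h k z < 0) ->
  (forall i, d.1 0 i < 0 -> 0 < z.1 0 i) -> (forall r, 0 <= d.2 0 r) ->
  exists2 eps, 0 < eps & E (z + eps *: d).
Proof.
move=> /P_EXFAP[[z1 z2] _] hz d1 d2.
pose c (j : 'I_K + 'I_m) := match j with
  | inl k => - h k z
  | inr i => if d.1 0 i < 0 then z.1 0 i else 1 end.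
pose b (j : 'I_K + 'I_m) := match j with
  | inl k => aff_form (w k) 0 d
  | inr i => if d.1 0 i < 0 then - d.1 0 i else 0 end.
have c0 j : 0 < c j.
  case: j => [k|i] /=; first by rewrite oppr_gt0.
  by case: ifPn => // /d1.
have [e e0 ebc] := exists_small_step b c0.
exists e => //; apply/P_EXFAP; split; [split=> i; rewrite /= !mxE|].
- have := ebc (inr i) => /=; case: ifPn => [_|]; first lra.
  rewrite -leNgt => di _; have := z1 i; rewrite mxE => zi.
  by rewrite addr_ge0// mulr_ge0// ltW.
- have := z2 i; rewrite mxE => zi; by rewrite addr_ge0// mulr_ge0// ltW.
- by move=> k; have := ebc (inl k); rewrite /h aff_formD /=; rewrite /h; lra.
Qed.

(** Off the facet hyperplanes all outputs could be increased together. *)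
Lemma strong_tight z : (0 < s)%N -> strong_frontier E z ->
  exists k, h k z = 0.
Proof.
move=> s0 [Ez zmin]; apply: contrapT => nt.
have hz k : h k z < 0.
  rewrite lt_neqAle; have /P_EXFAP[_ ->] := Ez; rewrite andbT.
  by apply/eqP => hk; apply: nt; exists k.
have [||e e0] := slack_move (d := (0, const_mx 1)) Ez hz.
- by move=> i /=; rewrite mxE ltxx.
- by move=> r /=; rewrite mxE.
apply: zmin.
- move=> /(congr1 (fun p : io_vec R m s => p.2 0 (Ordinal s0))); rewrite /= !mxE; lra.
- by apply: le_ioI => i; rewrite /= !mxE; lra.
Qed.

(** With positive inputs and no tight facet, all inputs could be decreased and
    all outputs increased.  A zero input blocks this, since no strictly smaller
    input is available. *)
Lemma weak_tight_or_zero z : weak_frontier E z ->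
  (exists k, h k z = 0) \/ (exists i, z.1 0 i = 0).
Proof.
move=> [Ez zmin]; apply: contrapT => /not_orP[nt nz].
have hz k : h k z < 0.
  rewrite lt_neqAle; have /P_EXFAP[_ ->] := Ez; rewrite andbT.
  by apply/eqP => hk; apply: nt; exists k.
have [||e e0] := slack_move (d := (const_mx (-1), const_mx 1)) Ez hz.
- move=> i _; rewrite lt_neqAle; have [[/(_ i)+ _] _] := Ez; rewrite mxE => ->.
  by rewrite andbT; apply/eqP => zi; apply: nz; exists i.
- by move=> r /=; rewrite mxE.
by apply: zmin; split=> i; rewrite /= !mxE; lra.
Qed.

Lemma strong_weak z : (0 < m)%N -> strong_frontier E z -> weak_frontier E z.
Proof.
move=> m0 [Ez zmin]; split=> // z' [z1 z2]; apply: zmin.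
  by move=> zz; have := z1 (Ordinal m0); rewrite zz ltxx.
by split=> i; exact: ltW.
Qed.

End frontiers.

(** * Improving a radial projection *)

Section russell.
Variables (R : realType) (m s K : nat).
Hypotheses (m_gt0 : (0 < m)%N) (s_gt0 : (0 < s)%N) (K_gt0 : (0 < K)%N).
Variables (w : 'I_K -> io_vec R m s) (psi : 'I_K -> R).
Hypothesis w_gt0 : forall k, pos_point (w k).
Implicit Types (z t d : io_vec R m s).
Let E := P_EXFA w psi.
Let h k z := aff_form (w k) (psi k) z.

Definition in_box t : Prop :=
  (forall i, 0 <= t.1 0 i <= 1) /\ (forall r, 1 <= t.2 0 r).

Definition admissible (B : set (io_vec R m s)) z t : Prop :=
  in_box t /\ B (rescale t z).

Definition one_io : io_vec R m s := (const_mx 1, const_mx 1).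

Lemma russell_valuesP (B : set (io_vec R m s)) z v :
  russell_values B z v <-> exists2 t, admissible B z t & v = g t.
Proof.
split=> [[t [t1 t2 Bt] <-]|[t [[t1 t2] Bt] ->]]; first by exists t.
by exists t.
Qed.

Lemma rescale1 z : rescale one_io z = z.
Proof.
by case: z => x y; congr (_, _); apply/rowP => i;
  rewrite !mxE mul1r.
Qed.

Lemma rescale_segment tau t z :
  rescale (one_io + tau *: (t - one_io)) z = z + tau *: (rescale t z - z).
Proof.
by case: z => x y; congr (_, _); apply/rowP => i;
  rewrite !mxE /=; ring.
Qed.

Lemma rescale_nonneg z t : pos_point z -> in_box t -> nonneg_point (rescale t z).
Proof.
move=> [x0 y0] [t1 t2]; split=> i; rewrite !mxE mulr_ge0//.
- by have /andP[] := t1 i.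
- by have := x0 i; rewrite mxE => /ltW.
- by apply: le_trans (t2 i).
- by have := y0 i; rewrite mxE => /ltW.
Qed.

(** Walk from the feasible [z] (scaling factors all 1) towards the infeasible
    rescaled point.  The first facet hyperplane met on the way carries an
    admissible projection, and stopping early means smaller distortions, hence
    a larger value of [g]. *)
Lemma infeasible_improve z t : E z -> pos_point z -> in_box t ->
  ~ E (rescale t z) ->
  exists2 t', admissible (strong_frontier E) z t' & g t < g t'.
Proof.
move=> Ez z0 tbox nEt.
have [k hk] : exists k, 0 < h k (rescale t z).
  apply: contrapT => nk; apply: nEt; apply/P_EXFAP.
  split=> [|k]; first exact: rescale_nonneg.
  by rewrite leNgt; apply/negP => ?; apply: nk; exists k.
have /P_EXFAP[_ hz] := Ez.
pose c j := - h j z; pose b j := h j (rescale t z) - h j z.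
have c0 j : 0 <= c j by rewrite /c oppr_ge0; exact: hz.
have cb : c k < b k by rewrite /c /b; move: hk; lra.
have [tau [tau0 tau1 hle [j hj]]] := exists_first_crossing c0 cb.
pose t' := one_io + tau *: (t - one_io).
have hE l : h l (rescale t' z) = h l z + tau * b l.
  by rewrite /t' rescale_segment /h aff_formD (aff_formB _ (psi l)).
have [t1 t2] := tbox.
have tbox' : in_box t'.
  split=> i; rewrite /t' /= !mxE.
    by have /andP[a0 a1] := t1 i; apply/andP; split; nra.
  by have := t2 i; nra.
have Et' : E (rescale t' z).
  apply/P_EXFAP; split; first exact: rescale_nonneg.
  by move=> l; rewrite -/(h l _) hE; have := hle l; rewrite /c; lra.
exists t'.
  split=> //; have tight : h j (rescale t' z) = 0 by rewrite hE hj /c subrr.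
  exact: tight_strong tight.
apply: g_lt => //.
- by move=> r; rewrite mxE; apply: lt_le_trans (tbox'.2 r).
- apply: le_ioI => i; rewrite /t' /= !mxE.
    by have /andP[a0 a1] := t1 i; nra.
  by have := t2 i; nra.
- by move=> tt; apply: nEt; rewrite tt.
Qed.

Definition output_bound z (k : 'I_K) (r : 'I_s) : R :=
  (psi k + dotv (w k).1 z.1) / ((w k).2 0 r * z.2 0 r).

(** Input factors are at most 1, so facet [k] bounds the value of all scaled
    outputs by [psi k + v^T x]; each term of that value is nonnegative. *)
Lemma output_factor_bounded z t k r : pos_point z -> in_box t ->
  E (rescale t z) -> t.2 0 r <= output_bound z k r.
Proof.
move=> z0 tbox Et; have [x0 y0] := z0; have [w1 w2] := w_gt0 k.
have [t1 t2] := tbox; have [_ /(_ k)] := Et.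
have yr i : 0 < z.2 0 i by have := y0 i; rewrite mxE.
have xr i : 0 < z.1 0 i by have := x0 i; rewrite mxE.
have ur i : 0 < (w k).2 0 i by have := w2 i; rewrite mxE.
have vr i : 0 < (w k).1 0 i by have := w1 i; rewrite mxE.
rewrite /output_bound ler_pdivlMr; last exact: mulr_gt0.
have -> : t.2 0 r * ((w k).2 0 r * z.2 0 r) =
  (w k).2 0 r * (rescale t z).2 0 r by rewrite /= mxE; ring.
have : dotv (w k).1 (rescale t z).1 <= dotv (w k).1 z.1.
  apply: ler_sum => i _; rewrite ler_pM2l// mxE ler_piMl ?(ltW (xr i))//.
  by have /andP[] := t1 i.
have : (w k).2 0 r * (rescale t z).2 0 r <= dotv (w k).2 (rescale t z).2.
  rewrite /dotv (bigD1 r)//= lerDl; apply: sumr_ge0 => i _.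
  rewrite !mxE !mulr_ge0 ?(ltW (ur i)) ?(ltW (yr i))//.
  exact: le_trans (t2 i).
lra.
Qed.

(** Raising a vanishing input factor from 0 to 1 gains 1 in the sum defining
    [g], while blowing up a single output factor costs less than 1, its inverse
    being at most 1 before and positive after. *)
Lemma zero_input_improve z t i : E z -> pos_point z -> in_box t ->
  t.1 0 i = 0 ->
  exists2 t', admissible (strong_frontier E) z t' & g t < g t'.
Proof.
move=> Ez z0 tbox ti0; have [t1 t2] := tbox.
pose k0 := Ordinal K_gt0; pose r0 := Ordinal s_gt0.
pose M := 1 + `|output_bound z k0 r0|.
have M1 : 1 <= M by rewrite lerDl.
pose q : io_vec R m s := (\row_j (if j == i then 1 else t.1 0 j),
                          \row_r (if r == r0 then M else t.2 0 r)).
have qbox : in_box q.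
  split=> j; rewrite /q /= mxE; case: ifP => // _.
  by rewrite ler01 lexx.
have nEq : ~ E (rescale q z).
  move=> /(output_factor_bounded k0 r0 z0 qbox); rewrite /q /= mxE eqxx.
  by have := ler_norm (output_bound z k0 r0); rewrite /M; lra.
have [t' adm gt'] := infeasible_improve Ez z0 qbox nEq.
exists t' => //; apply: le_lt_trans gt'; rewrite /g ler_pM2l; last first.
  by rewrite invr_gt0 ltr0n addn_gt0 m_gt0.
rewrite (bigD1 i)//= [X in _ + X <= _](bigD1 r0)//=.
rewrite [X in _ <= X + _](bigD1 i)//= [X in _ <= _ + X](bigD1 r0)//=.
rewrite !mxE !eqxx ti0.
have -> : \sum_(j < m | j != i) (\row_j (if j == i then 1 else t.1 0 j)) 0 j =
          \sum_(j < m | j != i) t.1 0 j.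
  by apply: eq_bigr => j /negbTE ji; rewrite mxE ji.
have -> : \sum_(r < s | r != r0)
    ((\row_r (if r == r0 then M else t.2 0 r)) 0 r)^-1 =
          \sum_(r < s | r != r0) (t.2 0 r)^-1.
  by apply: eq_bigr => r /negbTE rr; rewrite mxE rr.
have : 0 < M^-1 by rewrite invr_gt0; lra.
have : (t.2 0 r0)^-1 <= 1 by rewrite invf_le1// (lt_le_trans _ (t2 r0)).
lra.
Qed.

(** * Existence of the maxima *)

Lemma coord1_continuous (i : 'I_m) : continuous (fun t : io_vec R m s => t.1 0 i).
Proof.
move=> t; apply: (@continuous_comp _ _ _ fst (fun M : 'rV[R]_m => M 0 i)).
  exact: cvg_fst.
exact: coord_continuous.
Qed.

Lemma coord2_continuous (r : 'I_s) : continuous (fun t : io_vec R m s => t.2 0 r).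
Proof.
move=> t; apply: (@continuous_comp _ _ _ snd (fun M : 'rV[R]_s => M 0 r)).
  exact: cvg_snd.
exact: coord_continuous.
Qed.

Lemma aff_rescale_continuous z k : continuous (fun t => h k (rescale t z)).
Proof.
have -> : (fun t => h k (rescale t z)) = fun t : io_vec R m s =>
    - (\sum_(i < m) (w k).1 0 i * (t.1 0 i * z.1 0 i))
    + \sum_(r < s) (w k).2 0 r * (t.2 0 r * z.2 0 r) - psi k.
  apply/funext => t; rewrite /h /aff_form /dotv; congr (- _ + _ - _);
  by apply: eq_bigr => i _; rewrite mxE.
move=> t; apply: cvgB; last exact: cvg_cst.
apply: cvgD; first apply: cvgN.
- apply: cvg_big => [x|i _]; first exact: add_continuous.
  apply: cvgM; first exact: cvg_cst.
  by apply: cvgM; [exact: coord1_continuous|exact: cvg_cst].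
- apply: cvg_big => [x|i _]; first exact: add_continuous.
  apply: cvgM; first exact: cvg_cst.
  by apply: cvgM; [exact: coord2_continuous|exact: cvg_cst].
Qed.

Lemma g_continuous_at t : (forall r, t.2 0 r != 0) ->
  {for t, continuous (@g R m s)}.
Proof.
move=> t0; rewrite /g; apply: cvgM; first exact: cvg_cst.
apply: cvgD.
- apply: cvg_big => [x|i _]; first exact: add_continuous.
  exact: coord1_continuous.
- apply: cvg_big => [x|i _]; first exact: add_continuous.
  by apply: cvgV => //; exact: coord2_continuous.
Qed.

(** A description of the strong frontier by closed conditions, unlike its
    definition, which negates membership. *)
Let feasible_tight z : set (io_vec R m s) :=
  [set t | forall k, h k (rescale t z) <= 0] `&`
  [set t | exists k, h k (rescale t z) = 0].

Lemma admissibleP z t : pos_point z ->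
  admissible (strong_frontier E) z t <-> in_box t /\ feasible_tight z t.
Proof.
move=> z0; split=> [[tb st]|[tb [fe [k hk]]]]; split=> //.
  by split; [have [/P_EXFAP[]] := st|exact: strong_tight st].
apply: (tight_strong w_gt0 _ hk); apply/P_EXFAP; split=> //.
exact: rescale_nonneg.
Qed.

Lemma closed_feasible_tight z : closed (feasible_tight z).
Proof.
apply: closedI.
  have -> : [set t | forall k, h k (rescale t z) <= 0] =
      \bigcap_(k in setT) ((fun t => h k (rescale t z)) @^-1` [set x | x <= 0]).
    by apply/seteqP; split=> t /= ht k; [move=> _; exact: ht|exact: (ht k)].
  apply: closed_bigI => k _; apply: closed_comp; last exact: closed_le.
  by move=> t _; exact: aff_rescale_continuous.
have -> : [set t | exists k, h k (rescale t z) = 0] =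
    \bigcup_(k in setT) ((fun t => h k (rescale t z)) @^-1` [set 0]).
  by apply/seteqP; split=> [t [k hk]|t [k _ hk]]; exists k.
apply: closed_bigcup => [|k _]; first exact: finite_finset.
apply: closed_comp; last exact: closed_eq.
by move=> t _; exact: aff_rescale_continuous.
Qed.

Lemma admissible_nonempty z : E z -> pos_point z ->
  exists t, admissible (strong_frontier E) z t.
Proof.
(* Any factors with a zero input will do, as they can be improved. *)
move=> Ez z0; pose t : io_vec R m s := (0, const_mx 1).
have tb : in_box t by split=> i; rewrite /t /= mxE ?lexx ?ler01.
have [|t' adm _] := @zero_input_improve z t (Ordinal m_gt0) Ez z0 tb.
  by rewrite /t /= mxE.
by exists t'.
Qed.

(** The output factors have no upper bound in the definition of the measure;
    [output_bound] supplies one, so that the admissible factors are a closed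
    part of a compact box, away from the poles of [g]. *)
Lemma strong_maximum_exists z : E z -> pos_point z ->
  exists v, is_maximum (russell_values (strong_frontier E) z) v.
Proof.
move=> Ez z0; pose k0 := Ordinal K_gt0.
pose C := ([set x : 'rV[R]_m | forall i, `[0, 1]%classic (x ord0 i)] `*`
  [set y : 'rV[R]_s | forall r, `[1, output_bound z k0 r]%classic (y ord0 r)])
  `&` feasible_tight z.
have adm_C t : admissible (strong_frontier E) z t <-> C t.
  rewrite admissibleP//; split=> [[tb ft]|[[c1 c2] ft]].
    split=> //; split=> i /=; rewrite in_itv /=; first exact: tb.1.
    rewrite tb.2 /=; apply: output_factor_bounded => //.
    by have [_ []] := (admissibleP t z0).2 (conj tb ft).
  split=> //; split=> i.
    by have := c1 i; rewrite /= in_itv.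
  by have := c2 i; rewrite /= in_itv /= => /andP[].
have C0 : C !=set0.
  by have [t /adm_C Ct] := admissible_nonempty Ez z0; exists t.
have cC : compact C.
  apply: compact_closedI; last exact: closed_feasible_tight.
  apply: compact_setX.
    apply: (@rV_compact R m (fun=> `[0, 1]%classic)) => i.
    exact: segment_compact.
  apply: (@rV_compact R s (fun r => `[1, output_bound z k0 r]%classic)) => r.
  exact: segment_compact.
have gC : {within C, continuous (@g R m s)}.
  apply: continuous_in_subspaceT => t /set_mem /adm_C[[_ t2] _].
  by apply: g_continuous_at => r; rewrite gt_eqF// (lt_le_trans _ (t2 r)).
have [t /set_mem/adm_C Ct tmax] := compact_EVT_max C0 cC gC.
exists (g t); split; first by apply/russell_valuesP; exists t.
move=> _ /russell_valuesP[t' /adm_C Ct' ->]; apply: tmax.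
by rewrite inE.
Qed.

Lemma maximumE (A : set R) c : is_maximum A c -> maximum A = c.
Proof.
move=> [Ac uc]; apply: xget_unique => // d [Ad ud].
by apply/le_anti; rewrite uc//= ud.
Qed.

(** The extra points of the weak frontier have a vanishing input factor, and a
    strongly efficient projection does better. *)
Lemma strong_maximum_weak z v : E z -> pos_point z ->
  is_maximum (russell_values (strong_frontier E) z) v ->
  is_maximum (russell_values (weak_frontier E) z) v.
Proof.
move=> Ez z0 [/russell_valuesP[t [tb st] ->] ub]; split.
  by apply/russell_valuesP; exists t => //; split=> //; exact: strong_weak.
move=> _ /russell_valuesP[t' [tb' wt'] ->].
case: (weak_tight_or_zero wt') => [[k hk]|[i hi]].
  apply: ub; apply/russell_valuesP; exists t' => //; split=> //.
  by apply: tight_strong hk => //; case: wt'.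
have ti : t'.1 0 i = 0.
  move: hi => /eqP; rewrite mxE mulf_eq0 => /orP[/eqP//|].
  by rewrite gt_eqF//; have [/(_ i)] := z0; rewrite mxE.
have [t'' adm lt] := zero_input_improve Ez z0 tb' ti.
by apply: le_trans (ltW lt) _; apply: ub; apply/russell_valuesP; exists t''.
Qed.

(** * Strict monotonicity *)

(** An optimal choice of factors for the worse point [zb] has no vanishing
    input factor.  Applied to the better point [z], the same factors therefore
    give a point strictly beyond the tight facet hyperplane, hence infeasible,
    and they can be improved. *)
Lemma strong_maximum_lt z zb v vb : E z -> pos_point z -> E zb ->
  pos_point zb -> le_io z zb -> z <> zb ->
  is_maximum (russell_values (strong_frontier E) z) v ->
  is_maximum (russell_values (strong_frontier E) zb) vb -> vb < v.
Proof.
move=> Ez z0 Ezb zb0 lez nez [_ ub] [/russell_valuesP[t [tb st] ->] ubb].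
have [t1 t2] := tb.
have t1_gt0 i : 0 < t.1 0 i.
  rewrite lt_neqAle eq_sym; have /andP[-> _] := t1 i; rewrite andbT.
  apply/eqP => ti; have [t' adm] := zero_input_improve Ezb zb0 tb ti.
  by apply/negP; rewrite -leNgt; apply: ubb; apply/russell_valuesP; exists t'.
have t2_gt0 r : 0 < t.2 0 r by apply: lt_le_trans (t2 r).
have [k hk] := strong_tight s_gt0 st.
have [l1 l2] := le_ioE lez.
have nE : ~ E (rescale t z).
  move=> /P_EXFAP[_ /(_ k)]; apply/negP; rewrite -ltNge -hk.
  apply: aff_form_lt => //.
    by apply: le_ioI => i; rewrite !mxE ler_pM2l.
  move=> rr; case: (le_io_neq_coord lez nez) => -[i].
    rewrite -(ltr_pM2l (t1_gt0 i)).
    by have /(congr1 (fun p : io_vec R m s => p.1 0 i)) := rr; rewrite !mxE => ->; rewrite ltxx.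
  rewrite -(ltr_pM2l (t2_gt0 i)).
  by have /(congr1 (fun p : io_vec R m s => p.2 0 i)) := rr; rewrite !mxE => ->; rewrite ltxx.
have [t' adm lt] := infeasible_improve Ez z0 tb nE.
by apply: lt_le_trans lt _; apply: ub; apply/russell_valuesP; exists t'.
Qed.

End russell.

Theorem theorem4p4 (R : realType) (m s n : nat)
  (hm : (1 <= m)%N) (hs : (1 <= s)%N) (hn : (1 <= n)%N)
  (D : 'I_n -> io_vec R m s) (hD : forall j, pos_point (D j))
  (hex : exists F0 : set (io_vec R m s), FDEF (production_set D) F0)
  (K : nat) (F : 'I_K -> set (io_vec R m s))
  (hF : forall F0 : set (io_vec R m s),
      FDEF (production_set D) F0 <-> exists k, F0 = F k)
  (w : 'I_K -> io_vec R m s) (psi : 'I_K -> R)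
  (hw : forall k, [/\ pos_point (w k),
      valid_on (production_set D) (w k) (psi k) &
      F k = face_of (production_set D) (w k) (psi k)]) :
  let G := russell_strong (P_EXFA w psi) in
  let Gw := russell_weak (P_EXFA w psi) in
  (forall z : io_vec R m s, production_set D z -> pos_point z ->
     [/\ is_maximum (russell_values (strong_frontier (P_EXFA w psi)) z) (G z),
         is_maximum (russell_values (weak_frontier (P_EXFA w psi)) z) (Gw z) &
         Gw z = G z]) /\
  (forall z zb : io_vec R m s,
     production_set D z -> pos_point z ->
     production_set D zb -> pos_point zb ->
     le_io z zb -> (z.1, - z.2) <> (zb.1, - zb.2) ->
     G zb < G z).
Proof.
have K_gt0 : (0 < K)%N.
  by have [F0 /hF[k _]] := hex; apply: leq_ltn_trans (ltn_ord k).
have w_gt0 k : pos_point (w k) by case: (hw k).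
have sub z : production_set D z -> P_EXFA w psi z.
  move=> Pz; apply/P_EXFAP; split; first by case: Pz.
  by move=> k; have [_ valid _] := hw k; exact: valid.
move=> G Gw.
have Gmax z : production_set D z -> pos_point z ->
    is_maximum (russell_values (strong_frontier (P_EXFA w psi)) z) (G z).
  move=> /sub Ez z0.
  have [v vmax] := strong_maximum_exists hm hs K_gt0 w_gt0 Ez z0.
  by rewrite /G /russell_strong (maximumE vmax).
split=> [z Pz z0|z zb Pz z0 Pzb zb0 lez nez].
  have wmax := strong_maximum_weak hm hs K_gt0 w_gt0 (sub _ Pz) z0 (Gmax z Pz z0).
  by rewrite /Gw /russell_weak (maximumE wmax); split=> //; exact: Gmax.
apply: (strong_maximum_lt hm hs K_gt0 w_gt0 (sub _ Pz) z0 (sub _ Pzb) zb0) => //.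
- by move=> zz; apply: nez; rewrite zz.
- exact: Gmax.
- exact: Gmax.
Qed.
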